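(* Let $\ell(\alpha,0)$ be a line of $\mathbb A$ ($\alpha\in\mathrm{Hom}(U,W)$, $\alpha\neq0$), let $U'$ be a central complement of $\ker(\alpha)$ in $U$, and let $\mathcal R:=\big(\ell(\alpha,0)\cap(\mathrm{im}(\alpha)\oplus U')\big)\cup\{\mathrm{im}(\alpha)\}$, which is a regulus in $\mathbb P(K,\mathrm{im}(\alpha)\oplus U')$. Assume that $\ker(\alpha)$ is a central subspace of $U$. Then $$\ell(\alpha,0)=\{X\oplus\ker(\alpha)\mid X\in\mathcal R,\ X\ne\mathrm{im}(\alpha)\},$$ i.e., $\ell(\alpha,0)$ is the cone with vertex $\ker(\alpha)$ over the affine regulus $\mathcal R\setminus\{\mathrm{im}(\alpha)\}$.
   Context: $K$ is a not necessarily commutative field (division ring) with center $Z$, $V$ is a left vector space over $K$ of arbitrary dimension, $W\le V$ is a subspace with $W\ne\{0\}$, $W\neq V$, $U\le V$ is a fixed complement of $W$ ($V=W\oplus U$), and $(b_i)_{i\in I}$ is a fixed basis of $U$. Linear maps are written as exponents on the right and composed from left to right. $\mathcal S:=\{S\le V\mid V=W\oplus S\}$; for $\gamma\in\mathrm{Hom}(U,W)$ put $U^{(\gamma,1)}:=\{u^\gamma+u\mid u\in U\}$; the map $\gamma\mapsto U^{(\gamma,1)}$ is a bijection $\mathrm{Hom}(U,W)\to\mathcal S$. For $k\in K$ let $\lambda_k\in\mathrm{End}(U)$ be the $K$-linear map with $b_i\mapsto kb_i$. $\mathbb A$ is the affine space with point set $\mathcal S$ associated with the left $K$-vector space structure $U^{(\gamma,1)}+U^{(\eta,1)}=U^{(\gamma+\eta,1)}$,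 $k\cdot U^{(\gamma,1)}=U^{(\lambda_k\gamma,1)}$; its lines are the sets $\ell(\alpha,\beta):=\{U^{(\lambda_k\alpha+\beta,1)}\mid k\in K\}$ ($\alpha,\beta\in\mathrm{Hom}(U,W)$, $\alpha\ne0$). For a subspace $Y\le V$ write $\ell(\alpha,0)\cap Y:=\{X\cap Y\mid X\in\ell(\alpha,0)\}$. A subspace of $U$ is called central if it possesses a basis consisting of $Z$-linear combinations of the $b_i$. Every subspace of $U$ has a complement in $U$ that is central. A regulus in $\mathbb P(K,Y)$ (the projective space of subspaces of $Y$) is a set of subspaces of $Y$ which, for some nonzero left $K$-vector space $X$ with a basis $(x_j)_{j\in J}$ and some $K$-linear bijection $X\times X\to Y$, is the image of the standard regulus $\{X\times\{0\}\}\cup\{\{(x^{\lambda_k},x)\mid x\in X\}\mid k\in K\}$, where here $\lambda_k\in\mathrm{End}(X)$ is the linear map with $x_j\mapsto kx_j$. If $A$ is an element of a regulus $\mathcal R$, then $\mathcal R\setminus\{A\}$ is called an affine regulus (with respect to $A$). The cone with vertex $M$ over a set $\mathcal X$ of subspaces is the set $\{X\oplus M\mid X\in\mathcal X\}$. *)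

(* Defs.v *)
(* Left vector spaces over a division ring K are lmodTypes over K.  Linear maps
   are applied on the left, so u^(lambda_k alpha), composed from left to right,
   becomes alpha (lambda_k u).  The definitions below make sense over any
   nontrivial ring K. *)
From HB Require Import structures.
From mathcomp Require Import all_boot all_order all_algebra finmap.
From mathcomp Require Import boolp classical_sets.
Set Implicit Arguments.
Unset Strict Implicit.
Unset Printing Implicit Defensive.
Import GRing.Theory.
Local Open Scope classical_set_scope.
Local Open Scope ring_scope.

Section Spaces.
Variables (K : nzRingType) (V : lmodType K).
Implicit Types A B M Y : set V.

(* A subspace carrying Hom-spaces is a boolean predicate; under the classical
   axioms of boolp every subspace of V is of this form. *)
Definition subsp (W : submodClosed V) : Type := {v : V | v \in W}.
HB.instance Definition _ (W : submodClosed V) := SubChoice.on (subsp W).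
HB.instance Definition _ (W : submodClosed V) :=
  [SubChoice_isSubLmodule of subsp W by <:].

Definition sumset A B : set V := [set a + b | a in A & b in B].

(* Intended for subspaces A, B of V. *)
Definition direct A B : Prop := A `&` B = [set 0].
Definition is_direct_sum A B Y : Prop := sumset A B = Y /\ direct A B.

(* The cone with vertex M over XX; the set is {X (+) M | X in XX} only when
   every sum is direct, whence the second component. *)
Definition is_cone M (XX C : set (set V)) : Prop :=
  C = [set sumset X M | X in XX] /\ (forall X, XX X -> direct X M).

End Spaces.

Section Bases.
Variable K : nzRingType.

Definition center : set K := [set z | forall k, z * k = k * z].

Definition lincomb (I : choiceType) (V : lmodType K) (b : I -> V)
    (c : {fsfun I -> K with 0}) : V :=
  \sum_(i <- finsupp c) c i *: b i.

Definition is_basis (I : choiceType) (V : lmodType K) (b : I -> V) (S : set V) :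
    Prop :=
  (forall c, lincomb b c = 0 -> forall i, c i = 0) /\ range (lincomb b) = S.

Record basis (I : choiceType) (V : lmodType K) := Basis {
  basis_fun :> I -> V;
  basisP : is_basis basis_fun setT }.

Definition is_central (I : choiceType) (V : lmodType K) (b : basis I V)
    (S : set V) : Prop :=
  exists (J : choiceType) (c : J -> V), is_basis c S /\
    forall j, exists2 z : {fsfun I -> K with 0},
      (forall i, center (z i)) & c j = lincomb b z.

End Bases.

Section Lincomb.
Variables (K : nzRingType) (I : choiceType) (X : lmodType K).
Implicit Types (c d : {fsfun I -> K with 0}).

Lemma lincombE (b : I -> X) c (A : {fset I}) : (finsupp c `<=` A)%fset ->
  lincomb b c = \sum_(i <- A) c i *: b i.
Proof.
move=> sA; rewrite /lincomb (big_fset_incl _ sA) // => i _ iNc.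
by rewrite fsfun_dflt // scale0r.
Qed.

Definition fscomb (a : K) c d : {fsfun I -> K with 0} :=
  [fsfun i in (finsupp c `|` finsupp d)%fset => a * c i + d i].

Lemma fscombE a c d i : fscomb a c d i = a * c i + d i.
Proof.
rewrite fsfunE inE; case: ifPn => //; rewrite negb_or => /andP[ic id].
by rewrite !fsfun_dflt // mulr0 addr0.
Qed.

Lemma lincomb_fscomb (b : I -> X) a c d :
  lincomb b (fscomb a c d) = a *: lincomb b c + lincomb b d.
Proof.
set A := (finsupp c `|` finsupp d)%fset.
rewrite (@lincombE b (fscomb a c d) A); last first.
  by apply/fsubsetP => i; rewrite mem_finsupp fsfunE; case: ifP; rewrite ?eqxx.
rewrite (@lincombE b c A) ?fsubsetUl // (@lincombE b d A) ?fsubsetUr //.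
rewrite scaler_sumr -big_split /=; apply: eq_bigr => i _.
by rewrite fscombE scalerDl scalerA.
Qed.

Definition fsdelta (i : I) : {fsfun I -> K with 0} :=
  [fsfun j in [fset i]%fset => 1].

Lemma lincomb_fsdelta (b : I -> X) i : lincomb b (fsdelta i) = b i.
Proof.
rewrite (@lincombE b _ [fset i]%fset); last first.
  by apply/fsubsetP => j; rewrite mem_finsupp fsfunE; case: ifP; rewrite ?eqxx.
by rewrite big_seq_fset1 fsfunE inE eqxx scale1r.
Qed.

End Lincomb.

Section LinearExtension.
Variables (K : nzRingType) (I : choiceType) (V X : lmodType K).

Lemma linear_extension (b : basis I V) (f : I -> X) :
  {L : {linear V -> X} | forall i, L (b i) = f i}.
Proof.
have [bfree bspan] := basisP b.
have ex v : exists c, lincomb b c = v.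
  have [c _ <-] : range (lincomb b) v by rewrite bspan.
  by exists c.
pose co v := projT1 (cid (ex v)).
have coK v : lincomb b (co v) = v := projT2 (cid (ex v)).
have uniq_co c d : lincomb b c = lincomb b d -> c = d.
  move=> e; apply/fsfunP => i.
  have /bfree/(_ i) : lincomb b (fscomb (-1) d c) = 0.
    by rewrite lincomb_fscomb e scaleN1r addNr.
  by rewrite fscombE mulN1r addrC => /eqP; rewrite subr_eq0 => /eqP.
pose L v := lincomb f (co v).
have linL : linear L.
  move=> a u v; rewrite /L -lincomb_fscomb; congr lincomb; apply: uniq_co.
  by rewrite lincomb_fscomb !coK.
pose LM := GRing.isLinear.Build K V X *:%R L linL.
pose LL : {linear V -> X} := HB.pack L LM.
exists LL => i /=; rewrite /L (_ : co (b i) = fsdelta K i) ?lincomb_fsdelta //.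
by apply: uniq_co; rewrite coK lincomb_fsdelta.
Qed.

End LinearExtension.

Section Reguli.
Variable K : nzRingType.

(* lambda b k is the linear map with b i |-> k *: b i; for noncommutative K it
   is not the homothety v |-> k *: v. *)
Definition lambda (I : choiceType) (V : lmodType K) (b : basis I V) (k : K) :
    {linear V -> V} :=
  sval (linear_extension b (fun i => k *: b i)).

Lemma lambdaE (I : choiceType) (V : lmodType K) (b : basis I V) k i :
  lambda b k (b i) = k *: b i.
Proof. by rewrite /lambda; case: linear_extension. Qed.

Definition standard_regulus (J : choiceType) (X : lmodType K) (x : basis J X) :
    set (set (X * X)) :=
  [set [set p | p.2 = 0]] `|`
  [set [set (lambda x k v, v) | v in [set: X]] | k in [set: K]].

Definition is_regulus (V : lmodType K) (Y : set V) (R : set (set V)) : Prop :=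
  exists (X : lmodType K) (J : choiceType) (x : basis J X)
         (f : {linear (X * X)%type -> V}),
    [/\ exists v : X, v != 0, injective f, range f = Y &
        R = [set f @` S | S in standard_regulus x]].

Definition is_affine_regulus (V : lmodType K) (Y A : set V) (Q : set (set V)) :
    Prop :=
  exists R, [/\ is_regulus Y R, R A & Q = R `\ A].

End Reguli.

Section Lines.
Variables (K : nzRingType) (V : lmodType K) (W U : submodClosed V).

(* U^(gamma,1) *)
Definition graph (gamma : {linear subsp U -> subsp W}) : set V :=
  [set val (gamma u) + val u | u in [set: subsp U]].

Definition line (I : choiceType) (b : basis I (subsp U))
    (alpha beta : {linear subsp U -> subsp W}) : set (set V) :=
  [set graph ((alpha \o lambda b k) \+ beta) | k in [set: K]].

Definition kernel (alpha : {linear subsp U -> subsp W}) : set (subsp U) :=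
  [set u | alpha u = 0].

Definition image_in (alpha : {linear subsp U -> subsp W}) : set V :=
  [set val (alpha u) | u in [set: subsp U]].

End Lines.

(* Main.v *)
Require Import Defs.
From HB Require Import structures.
From mathcomp Require Import all_boot all_order all_algebra finmap.
From mathcomp Require Import boolp classical_sets.
Set Implicit Arguments.
Unset Strict Implicit.
Unset Printing Implicit Defensive.
Import GRing.Theory.
Local Open Scope classical_set_scope.
Local Open Scope ring_scope.

(** Write U as the direct sum of ker(alpha) and U'.  The map lambda_k
    multiplies every Z-linear combination of the b_i by k, because central
    coefficients commute with k.  So it maps each central subspace of U into
    itself, and acts there as the lambda_k of any basis of Z-linear combinations
    ([central_module]).  The two central subspaces use one half of this each.

    Stability of ker(alpha): if u = n + u' with n in ker(alpha) and u' in U',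
    then alpha (lambda_k u) = alpha (lambda_k u').  Hence the point X_k of the
    line, which is the graph of u |-> alpha (lambda_k u), is the sum of
    ker(alpha) and of the part T_k of that graph lying over U' ([graph_cone]).
    As the sum of W and U is direct, T_k is also the trace of X_k on
    im(alpha) + U' ([graph_trace]), it meets ker(alpha) only in 0
    ([partial_graph_direct]), and it differs from im(alpha)
    ([partial_graph_neq_image]), so that removing im(alpha) from the regulus
    leaves exactly the T_k.

    Restriction to U': alpha is injective on U', with image im(alpha), so
    (x, y) |-> alpha x + y is a linear bijection of U' x U' onto im(alpha) + U'.
    It maps U' x {0} onto im(alpha) and {(lambda_k x, x) | x in U'} onto T_k.
    Since lambda_k restricts to the lambda_k of a basis of U', the sets so
    mapped form the standard regulus of U' ([regulus_of_traces]). *)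

(** * Linear combinations and bases *)

Section Bases.
Variable K : nzRingType.

Lemma linear_lincomb (I : choiceType) (V X : lmodType K) (L : {linear V -> X})
    (b : I -> V) c : L (lincomb b c) = lincomb (L \o b) c.
Proof. by rewrite /lincomb linear_sum; apply: eq_bigr => i _; rewrite linearZ. Qed.

Lemma eq_linear_basis (I : choiceType) (V X : lmodType K) (b : basis I V)
    (L M : {linear V -> X}) : (forall i, L (b i) = M (b i)) -> L =1 M.
Proof.
move=> LM v; have [_ bspan] := basisP b.
have [c _ <-] : range (lincomb b) v by rewrite bspan.
by rewrite !linear_lincomb /lincomb; apply: eq_bigr => i _ /=; rewrite LM.
Qed.

(** A subspace given as a bare set becomes a module X of its own, so that the
    standard regulus over it can be formed. *)
Lemma subspace_module (J : choiceType) (V : lmodType K) (c : J -> V)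
    (S : set V) : is_basis c S ->
  exists (X : lmodType K) (x : basis J X) (iota : {linear X -> V}),
    [/\ injective iota, range iota = S & forall j, iota (x j) = c j].
Proof.
move=> [cfree cspan].
have S_comb a u v : S u -> S v -> S (a *: u + v).
  rewrite -cspan => -[d _ <-] [e _ <-]; exists (fscomb a d e) => //.
  exact: lincomb_fscomb.
have S_gen j : S (c j).
  by rewrite -cspan; exists (fsdelta K j) => //; exact: lincomb_fsdelta.
have S0 : S 0.
  rewrite -cspan; exists [fsfun] => //.
  by rewrite /lincomb finsupp0 big_seq_fset0.
pose p : {pred V} := fun v => `[< S v >].
have pE v : (v \in p) = `[< S v >] by [].
have p_submod : submod_closed p.
  split; first by rewrite pE; exact/asboolP.
  move=> a u v; rewrite !pE => /asboolP Su /asboolP Sv.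
  exact/asboolP/S_comb.
pose P : submodClosed V := HB.pack p (GRing.isSubmodClosed.Build K V p p_submod).
have cP j : c j \in P by exact/asboolP/S_gen.
pose iota : {linear subsp P -> V} := val.
pose x j : subsp P := Sub (c j) (cP j).
have xE j : iota (x j) = c j by exact: SubK.
have lincombx d : iota (lincomb x d) = lincomb c d.
  by rewrite linear_lincomb /lincomb; apply: eq_bigr => j _; rewrite /= -xE.
have xbasis : is_basis x setT.
  split=> [d d0 j|].
    by apply: (cfree d); rewrite -lincombx d0 linear0.
  rewrite -subTset => v _.
  have [d _ dv] : range (lincomb c) (iota v).
    by rewrite cspan; exact/asboolP/(valP v).
  by exists d => //; apply: val_inj; rewrite -[RHS]dv -lincombx.
exists (subsp P), (Basis xbasis), iota; split => //; first exact: val_inj.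
apply/seteqP; split=> [_ [v _ <-]|v Sv]; first exact/asboolP/(valP v).
have vP : v \in P by exact/asboolP.
by exists (Sub v vP) => //; exact: SubK.
Qed.

(** * The maps lambda_k and central subspaces *)

Section Central.
Variables (I : choiceType) (V : lmodType K) (b : basis I V).

Lemma lambda_central_comb k (z : {fsfun I -> K with 0}) :
  (forall i, center (z i)) -> lambda b k (lincomb b z) = k *: lincomb b z.
Proof.
move=> zZ; rewrite linear_lincomb /lincomb scaler_sumr; apply: eq_bigr => i _ /=.
by rewrite lambdaE !scalerA zZ.
Qed.

(** The restriction of lambda_k to a central subspace is the lambda_k of the
    basis that makes it central, since both multiply each element of that basis
    by k.  For another basis of the same subspace this can fail when
    K is not commutative. *)
Lemma central_module (S : set V) : is_central b S ->
  exists (X : lmodType K) (J : choiceType) (x : basis J X)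
         (iota : {linear X -> V}),
    [/\ injective iota, range iota = S &
        forall k v, iota (lambda x k v) = lambda b k (iota v)].
Proof.
move=> [J [c [cS cZ]]].
have [X [x [iota [iota_inj iotaS xc]]]] := subspace_module cS.
exists X, J, x, iota; split=> // k.
apply: (eq_linear_basis (b := x) (L := iota \o lambda x k)
                        (M := lambda b k \o iota)) => j /=.
by rewrite lambdaE linearZ xc; have [z /lambda_central_comb + ->] := cZ j => ->.
Qed.

Lemma lambda_stable (S : set V) k u : is_central b S -> S u -> S (lambda b k u).
Proof.
move=> /central_module[X [J [x [iota [_ <- iota_lambda]]]]] [v _ <-].
by exists (lambda x k v).
Qed.

End Central.
End Bases.

(** * Graphs of linear maps between independent subspaces *)

Section Graphs.
Variables (K : nzRingType) (V : lmodType K) (W U : submodClosed V).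
Hypothesis directWU : direct [set` W] [set` U].

Lemma direct_components (w w' : subsp W) (u u' : subsp U) :
  val w + val u = val w' + val u' -> w = w' /\ u = u'.
Proof.
move=> e; have e' : val (w - w') = val (u' - u).
  by rewrite !raddfB /=; apply/eqP; rewrite subr_eq addrAC eq_sym subr_eq e addrC.
have : ([set` W] `&` [set` U]) (val (w - w')).
  by split; [exact: (valP (w - w')) | rewrite e'; exact: (valP (u' - u))].
rewrite directWU => /= e0; split; apply/eqP.
  by rewrite -subr_eq0; apply/eqP/val_inj.
by rewrite eq_sym -subr_eq0; apply/eqP/val_inj; rewrite -e'.
Qed.

Lemma direct_image_val (alpha : {linear subsp U -> subsp W}) (S : set (subsp U)) :
  S 0 -> direct (image_in alpha) (val @` S).
Proof.
move=> S0; apply/seteqP; split=> [_ [[u _ <-] [s _ e]]|_ ->].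
  have [|-> _] := @direct_components (alpha u) 0 0 s; last by rewrite raddf0.
  by rewrite !raddf0 addr0 add0r e.
by split; exists 0; rewrite ?linear0 ?raddf0.
Qed.

Variables (alpha : {linear subsp U -> subsp W}) (U' : set (subsp U)).
Hypothesis splitU : is_direct_sum (kernel alpha) U' [set: subsp U].

Lemma ker_complement u : exists n u', [/\ alpha n = 0, U' u' & u = n + u'].
Proof.
have [+ _] := splitU => /seteqP[_ /(_ u I)].
by case=> n n0 [u' Uu' <-]; exists n, u'.
Qed.

Lemma ker_meet_complement u : U' u -> alpha u = 0 -> u = 0.
Proof.
have [_ d] := splitU => Uu au.
by have : (kernel alpha `&` U') u by []; rewrite d.
Qed.

Lemma complement0 : U' 0.
Proof.
have [_ d] := splitU.
by have : [set 0 : subsp U] 0 by []; rewrite -d => -[].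
Qed.

Lemma image_complement u : exists2 u', U' u' & alpha u = alpha u'.
Proof.
have [n [u' [n0 Uu' ->]]] := ker_complement u.
by exists u'; rewrite // linearD n0 add0r.
Qed.

Let Y := sumset (image_in alpha) (val @` U').

Definition partial_graph (gamma : subsp U -> subsp W) : set V :=
  [set val (gamma u) + val u | u in U'].

Section OneGraph.
(* For gamma = alpha \o lambda b k, gamma_ker says that lambda b k preserves
   ker(alpha); this is where ker(alpha) has to be central. *)
Variable gamma : {linear subsp U -> subsp W}.
Hypothesis gamma_im : forall u, exists u0, gamma u = alpha u0.
Hypothesis gamma_ker : forall u, alpha u = 0 -> gamma u = 0.

(** By uniqueness of components, a vector of the graph that lies in im(alpha) + U'
    has its U-component in U'; the converse needs the values of gamma to lie
    in im(alpha). *)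
Lemma graph_trace : graph gamma `&` Y = partial_graph gamma.
Proof.
apply/seteqP; split=> [_ [[u _ <-] [_ [u0 _ <-] [_ [u' Uu' <-]]]]|_ [u Uu <-]].
  by case/direct_components=> _ <-; exists u'.
split; first by exists u.
have [u0 e] := gamma_im u.
exists (val (gamma u)); first by exists u0; rewrite // e.
by exists (val u) => //; exists u.
Qed.

(** Since gamma vanishes on ker(alpha), the graph contains ker(alpha) itself and
    is determined by its part over a complement. *)
Lemma graph_cone : graph gamma = sumset (partial_graph gamma) (val @` kernel alpha).
Proof.
apply/seteqP; split=> [_ [u _ <-]|_ [_ [u Uu <-] [_ [n n0 <-] <-]]].
  have [n [u' [n0 Uu' ->]]] := ker_complement u.
  exists (val (gamma u') + val u'); first by exists u'.
  exists (val n); first by exists n.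
  by rewrite linearD (gamma_ker n0) add0r raddfD -addrA [X in _ = _ + X]addrC.
exists (u + n) => //.
by rewrite linearD (gamma_ker n0) addr0 raddfD addrA.
Qed.

Lemma partial_graph_direct : direct (partial_graph gamma) (val @` kernel alpha).
Proof.
apply/seteqP; split=> [_ [[u Uu <-] [n n0 e]]|_ ->]; last first.
  split; exists 0; rewrite ?linear0 ?raddf0 ?addr0 //; first exact: complement0.
  by rewrite /kernel /= linear0.
have [gu nu] := @direct_components 0 (gamma u) n u (etrans (add0r _) e).
by rewrite -gu -nu (@ker_meet_complement n) ?raddf0 ?addr0 // nu.
Qed.

(** A graph meets W only in 0, whereas im(alpha) is a nonzero subspace of W. *)
Lemma partial_graph_neq_image :
  (exists u, alpha u != 0) -> partial_graph gamma <> image_in alpha.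
Proof.
move=> [u /eqP au] e; apply: au.
have : image_in alpha (val (alpha u)) by exists u.
rewrite -e => -[u' _ e'].
have [<- u'0] := @direct_components (gamma u') (alpha u) u' 0
  (etrans e' (esym (addr0 _))).
by rewrite u'0 linear0.
Qed.

End OneGraph.

(** * The regulus formed by im(alpha) and the traces of the line *)

Variables (I : choiceType) (b : basis I (subsp U)).
Hypothesis centralU' : is_central b U'.
Hypothesis alpha_neq0 : exists u, alpha u != 0.

(** The coordinate space of the regulus is U' itself, with the map
    (x, y) |-> alpha x + y. *)
Lemma regulus_of_traces :
  is_regulus Y ([set partial_graph (alpha \o lambda b k) | k in [set: K]]
                `|` [set image_in alpha]).
Proof.
have [X [J [x [iota [iota_inj iotaU' iota_lambda]]]]] := central_module centralU'.
have Uiota v : U' (iota v) by rewrite -iotaU'; exists v.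
have iota_surj u : U' u -> exists v, iota v = u.
  by rewrite -iotaU' => -[v _ <-]; exists v.
pose f (p : X * X) : V := val (alpha (iota p.1)) + val (iota p.2).
have f_linear : linear f.
  by move=> a p q; rewrite /f /= !linearP /= scalerDr addrACA.
pose F : {linear (X * X)%type -> V} :=
  HB.pack f (GRing.isLinear.Build K _ V *:%R f f_linear).
have FE p : F p = val (alpha (iota p.1)) + val (iota p.2) by [].
exists X, J, x, F; split.
- have [u au] := alpha_neq0; have [u' Uu' e] := image_complement u.
  have [v uv] := iota_surj u' Uu'; exists v; apply: contraNneq au => v0.
  by rewrite e -uv v0 !linear0.
- move=> [p1 p2] [q1 q2] /direct_components[/= e1 /iota_inj->].
  congr pair; apply: iota_inj; apply/eqP; rewrite -subr_eq0 -linearB; apply/eqP.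
  by apply: ker_meet_complement => //; rewrite !linearB e1 subrr.
- apply/seteqP; split=> [_ [p _ <-]|].
    exists (val (alpha (iota p.1))); first by exists (iota p.1).
    by exists (val (iota p.2)) => //; exists (iota p.2).
  move=> _ [_ [u _ <-] [_ [_ /iota_surj[p2 <-] <-] <-]].
  have [_ /iota_surj[p1 <-] ->] := image_complement u.
  by exists (p1, p2).
- have im_inf : F @` [set p | p.2 = 0] = image_in alpha.
    apply/seteqP; split=> [_ [p p0 <-]|_ [u _ <-]].
      by exists (iota p.1); rewrite // FE (p0 : p.2 = 0) linear0 raddf0 addr0.
    have [_ /iota_surj[p1 <-] ->] := image_complement u.
    by exists (p1, 0); rewrite // FE linear0 raddf0 addr0.
  have im_k k : F @` [set (lambda x k v, v) | v in [set: X]]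
                = partial_graph (alpha \o lambda b k).
    apply/seteqP; split=> [_ [_ [v _ <-] <-]|_ [_ /iota_surj[v <-] <-]].
      by exists (iota v); rewrite // FE iota_lambda.
    by exists (lambda x k v, v); [exists v | rewrite FE iota_lambda].
  apply/seteqP; split=> [_ [[k _ <-]|->]|_ [_ [->|[k _ <-]] <-]].
  + by exists [set (lambda x k v, v) | v in [set: X]]; [right; exists k |].
  + by exists [set p | p.2 = 0]; [left |].
  + by right.
  + by left; exists k.
Qed.

End Graphs.

Lemma line_through0 (K : nzRingType) (V : lmodType K) (W U : submodClosed V)
    (I : choiceType) (b : basis I (subsp U)) (alpha : {linear subsp U -> subsp W}) :
  line b alpha \0 = [set graph (alpha \o lambda b k) | k in [set: K]].
Proof.
rewrite /line; apply: eq_imagel => k _; apply: eq_imagel => u _.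
by rewrite /= addr0.
Qed.

Theorem corollary4p12 (K : unitRingType)
    (hK : forall x : K, x != 0 -> x \is a GRing.unit)
    (V : lmodType K) (W U : submodClosed V)
    (hW0 : [set` W] <> [set 0]) (hWV : [set` W] <> [set: V])
    (hWU : is_direct_sum [set` W] [set` U] [set: V])
    (I : choiceType) (b : basis I (subsp U))
    (alpha : {linear subsp U -> subsp W})
    (halpha : exists u, alpha u != 0)
    (U' : set (subsp U))
    (hU'c : is_central b U')
    (hU' : is_direct_sum (kernel alpha) U' [set: subsp U])
    (hker : is_central b (kernel alpha)) :
  let l := line b alpha \0 in
  let Y := sumset (image_in alpha) (val @` U') in
  let R := [set X `&` Y | X in l] `|` [set image_in alpha] in
  [/\ direct (image_in alpha) (val @` U'),
      is_regulus Y R,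
      l = [set sumset X (val @` kernel alpha)
            | X in [set X | R X /\ X <> image_in alpha]],
      is_affine_regulus Y (image_in alpha) (R `\ image_in alpha) &
      is_cone (val @` kernel alpha) (R `\ image_in alpha) l].
Proof.
move=> l Y R; have [_ dWU] := hWU.
pose gamma k : {linear subsp U -> subsp W} := alpha \o lambda b k.
pose T k := partial_graph U' (gamma k).
have gamma_im k u : exists u0, gamma k u = alpha u0 by exists (lambda b k u).
have gamma_ker k u : alpha u = 0 -> gamma k u = 0.
  exact: (@lambda_stable _ _ _ b _ k u hker).
have lE : l = [set graph (gamma k) | k in [set: K]] by exact: line_through0.
have TE k : graph (gamma k) `&` Y = T k by exact: (graph_trace dWU).
have RE : R = [set T k | k in [set: K]] `|` [set image_in alpha].
  rewrite /R lE; congr (_ `|` _); apply/seteqP.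
  split=> [_ [_ [k _ <-] <-]|_ [k _ <-]]; first by exists k.
  by exists (graph (gamma k)) => //; exists k.
have T_neq k : T k <> image_in alpha by exact: (partial_graph_neq_image dWU).
have affRE : R `\ image_in alpha = [set T k | k in [set: K]].
  rewrite RE; apply/seteqP; split=> [X [[//|->] /(_ erefl)//]|_ [k _ <-]].
  by split; [left; exists k | exact: T_neq].
have coneE : l = [set sumset X (val @` kernel alpha) | X in R `\ image_in alpha].
  rewrite affRE lE; apply/seteqP; split=> [_ [k _ <-]|_ [_ [k _ <-] <-]].
    by exists (T k); [exists k | rewrite (graph_cone hU' (gamma_ker k))].
  by exists k; rewrite // (graph_cone hU' (gamma_ker k)).
have regR : is_regulus Y R by rewrite RE; exact: (regulus_of_traces dWU hU').
split=> //.
- exact: (direct_image_val dWU alpha (complement0 hU')).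
- by exists R; split => //; right.
- split=> //; rewrite affRE => _ [k _ <-].
  exact: (partial_graph_direct dWU hU').
Qed.
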